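(* Fix a positive integer $d\ge 2$, and let $D$ be a $d$-ary tree (with $|D|\ge 2$). For every positive integer $n\equiv 1 \bmod (d-1)$ and every $d$-ary tree $T$ with $\lfloor n^{1/2}\rfloor$ leaves, there exists a strictly $d$-ary tree $T^*$ with $n$ leaves such that the asymptotic formula $$\gamma(D,T)=\gamma(D,T^* )+\mathcal{O}(n^{-1/2})$$ holds as $n\to\infty$, and the $\mathcal{O}$-constant depends on $d$ only. In particular, $$i_d(D)=I_d(D).$$
   Context: All trees are finite and rooted, with unordered children; isomorphism means isomorphism of rooted trees. The single vertex is regarded as a tree whose only vertex is both root and leaf. For a rooted tree $T$, $|T|$ denotes its number of leaves. For an integer $d\ge 2$, a $d$-ary tree is a rooted tree in which every non-leaf vertex has between $2$ and $d$ children; it is strictly $d$-ary if every non-leaf vertex has exactly $d$ children. (An $n$-leaf strictly $d$-ary tree exists iff $n\ge 1$ and $n\equiv 1 \bmod (d-1)$.) For a nonempty set $S$ of leaves of $T$, the subtree of $T$ induced by $S$ is obtained by taking the minimal subtree of $T$ containing the leaves in $S$, rooting it at the most recent common ancestor of $S$, and suppressing (contracting) all non-root vertices of degree $2$. Let $c(D,T)$ be the number of sets of $|D|$ leaves of $T$ whose induced subtree is isomorphic to $D$, and for $|T|\ge |D|$ let $\gamma(D,T)=c(D,T)/\binom{|T|}{|D|}$. (The asymptotic formula in the claim concerns large $n$, for which $\lfloor n^{1/2}\rfloor\ge |D|$, so that both densities are defined.) For a $d$-ary tree $D$ define $$I_d(D)=\limsup_{n\to\infty}\ \max_{|T|=n,\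 T\ d\text{-ary}}\gamma(D,T),\qquad i_d(D)=\limsup_{n\to\infty}\ \max_{|T|=n,\ T\text{ strictly }d\text{-ary}}\gamma(D,T),$$ where in the second definition $n$ ranges over integers $n\equiv 1 \bmod (d-1)$.
   Formalization: The O-constant is allowed to depend on D as well as on d (not on n, T or T* ): a constant depending on d only is impossible, as the trees D consisting of two a-leaf caterpillars joined at a root show when a grows. *)

(* Defs.v *)
From HB Require Import structures.
From mathcomp Require Import all_boot all_order all_algebra.
From mathcomp Require Import boolp classical_sets reals sequences.

Set Implicit Arguments.
Unset Strict Implicit.
Unset Printing Implicit Defensive.

Import Order.TTheory GRing.Theory Num.Theory.

Local Open Scope ring_scope.
Local Open Scope classical_set_scope.

(* A finite rooted tree is its root together with the list of the subtrees
   rooted at the children of the root; [iso] below forgets the order of the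
   children. *)
Inductive tree : Type := Node of seq tree.

Definition leaf : tree := Node [::].

(* An isomorphism of rooted trees sends root to root, hence amounts to a
   bijection between the children of the two roots, together with isomorphisms
   between the subtrees rooted at matched children. *)
Inductive iso : tree -> tree -> Prop :=
| Iso (ts us : seq tree) (f : 'I_(size ts) -> 'I_(size us)) of
    bijective f
  & (forall i : 'I_(size ts), iso (nth leaf ts i) (nth leaf us (f i))) :
    iso (Node ts) (Node us).

(* The single vertex counts as one leaf. *)
Fixpoint nleaves (t : tree) : nat :=
  let: Node ts := t in if nilp ts then 1%N else sumn (map nleaves ts).

Fixpoint dary (d : nat) (t : tree) : bool :=
  let: Node ts := t in
  (nilp ts || (2 <= size ts <= d)%N) && all (dary d) ts.

Fixpoint strictly_dary (d : nat) (t : tree) : bool :=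
  let: Node ts := t in
  (nilp ts || (size ts == d)) && all (strictly_dary d) ts.

(* The leaves of [t] are numbered 0, ..., nleaves t - 1 from left to right, and
   [P] selects some of them; in the inner loop [o] is the number of leaves lying
   to the left of the next child. A vertex with no selected leaf below it is not
   in the minimal subtree. A vertex with exactly one child left is either a
   non-root vertex of degree 2, which is suppressed, or lies strictly above the
   most recent common ancestor of the selected leaves, hence is dropped; both
   times its only remaining child takes its place. The result is [None] iff no
   leaf is selected. *)
Fixpoint induced (P : pred nat) (t : tree) : option tree :=
  let: Node ts := t in
  if nilp ts then (if P 0%N then Some leaf else None) else
  let fix loop (o : nat) (ts : seq tree) : seq tree :=
    if ts is t1 :: ts1 then
      let us := loop (o + nleaves t1)%N ts1 in
      if induced (fun i => P (o + i)%N) t1 is Some u then u :: us else us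
    else [::] in
  match loop 0%N ts with
  | [::] => None
  | [:: u] => Some u
  | us => Some (Node us)
  end.

Definition induced_subtree (T : tree) (S : {set 'I_(nleaves T)}) : option tree :=
  induced [pred i : nat | i \in [seq val j | j in S]] T.

Definition copies (D T : tree) : nat :=
  #|[set S : {set 'I_(nleaves T)} |
      (#|S| == nleaves D) &&
      (if induced_subtree S is Some U then `[< iso D U >] else false)]|.

(* Meaningful for nleaves D <= nleaves T only; otherwise the value is 0 / 0 = 0. *)
Definition density (R : realType) (D T : tree) : R :=
  (copies D T)%:R / 'C(nleaves T, nleaves D)%:R.

(* Only finitely many trees compete (every non-leaf vertex has at least 2
   children), so the supremum is a maximum as soon as a competitor exists. *)
Definition max_density (R : realType) (C : tree -> bool) (D : tree) (n : nat) : R :=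
  sup [set density R D T | T in [set T | C T /\ nleaves T = n]].

Definition inducibility (R : realType) (d : nat) (D : tree) : R :=
  limn_sup (fun n => max_density R (dary d) D n).

(* The integers n >= 1 with n = 1 mod (d - 1) are enumerated increasingly as
   j (d - 1) + 1, j = 0, 1, 2, ... *)
Definition strict_inducibility (R : realType) (d : nat) (D : tree) : R :=
  limn_sup (fun j => max_density R (strictly_dary d) D (j * d.-1).+1).

(* Main.v *)
(* Let T have m leaves, and k = |D|. To obtain T', replace every leaf of T by a
   strictly d-ary caterpillar with at least a leaves, and give every internal
   vertex of T enough extra leaf children to have d children. A set of k leaves
   with at most one leaf in each caterpillar and no extra leaf induces the same
   tree as the corresponding set of leaves of T, and each k-set of leaves of T
   arises in this way at least a^k times. Applied to copies and to non-copies of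
   D, this gives |gamma(D,T) - gamma(D,T')| <= 1 - C(m,k) a^k / C(n,k), which is
   O(n^(-1/2)) if m ~ n^(1/2) and a ~ n/m. Since there is an admissible n
   between m^2 and (m+1)^2 for every large m, the limits superior coincide. *)

Require Import Defs.
From HB Require Import structures.
From mathcomp Require Import all_boot all_order all_algebra.
From mathcomp Require Import boolp classical_sets reals topology normedtype sequences.
From mathcomp Require Import zify ring lra.

Set Implicit Arguments.
Unset Strict Implicit.
Unset Printing Implicit Defensive.

Import Order.TTheory GRing.Theory Num.Theory.

(** * Induced subtrees of blow-ups *)

(** Children are nested inside a list, so the induction runs with a second predicate [Q] on
    forests. *)
Lemma tree_forest_ind (P : tree -> Prop) (Q : seq tree -> Prop) :
  Q [::] -> (forall t ts, P t -> Q ts -> Q (t :: ts)) ->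
  (forall ts, Q ts -> P (Node ts)) -> forall t, P t.
Proof.
move=> Q0 Qc PN; fix IH 1 => -[ts]; apply: PN.
by elim: ts => [|t ts IHts]; [exact: Q0 | apply: Qc; [exact: IH | exact: IHts]].
Qed.

Definition forest_nleaves (ts : seq tree) : nat := sumn (map nleaves ts).

Lemma nleaves_Node t ts : nleaves (Node (t :: ts)) = forest_nleaves (t :: ts).
Proof. by []. Qed.

Lemma nleaves_gt0 t : 0 < nleaves t.
Proof.
move: t; apply: (tree_forest_ind (Q := fun ts => ~~ nilp ts -> 0 < forest_nleaves ts)).
- by [].
- by move=> t ts t0 _ _; rewrite /forest_nleaves /= ltn_addr.
- by case=> [|t ts] => [_|]; [|apply].
Qed.

(* The inner loop of [induced], with the offset absorbed into [P]. *)
Fixpoint induced_forest (P : pred nat) (ts : seq tree) : seq tree :=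
  if ts is t :: ts1 then
    oapp (fun u => [:: u]) [::] (induced P t)
      ++ induced_forest (fun i => P (nleaves t + i)) ts1
  else [::].

Definition root_of_forest (us : seq tree) : option tree :=
  match us with
  | [::] => None
  | [:: u] => Some u
  | [:: u, v & us] => Some (Node [:: u, v & us])
  end.

Lemma induced_Node P t ts :
  induced P (Node (t :: ts)) = root_of_forest (induced_forest P (t :: ts)).
Proof.
pose loop := fix loop (o : nat) (ts : seq tree) : seq tree :=
  if ts is t1 :: ts1 then
    let us := loop (o + nleaves t1) ts1 in
    if induced (fun i => P (o + i)) t1 is Some u then u :: us else us
  else [::].
(* The offset changes at each recursive call, so the claim is generalised over it. *)
suff loopE us o : loop o us = induced_forest (fun i => P (o + i)) us.
  by rewrite -[LHS]/(root_of_forest (loop 0 (t :: ts))) loopE.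
elim: us o => [//|u us IH] o; rewrite /= IH.
have -> : (fun i => P (o + nleaves u + i)) = (fun i => P (o + (nleaves u + i))).
  by apply/funext => i; rewrite addnA.
by case: (induced _ u).
Qed.

Lemma eq_induced P P' t :
  (forall i, i < nleaves t -> P i = P' i) -> induced P t = induced P' t.
Proof.
pose stF ts := forall P P', (forall i, i < forest_nleaves ts -> P i = P' i) ->
  induced_forest P ts = induced_forest P' ts.
move: t P P'; apply: (tree_forest_ind (Q := stF)).
- by [].
- move=> t ts IHt IHts P P' e; rewrite /= (IHt P P') => [|i it].
    congr cat; apply: IHts => i its.
    by apply: e; rewrite /forest_nleaves /= ltn_add2l.
  by apply: e; rewrite /forest_nleaves /= ltn_addr.
- move=> [|t ts] IH P P' e; first by rewrite /= e.
  by rewrite !induced_Node (IH P P').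
Qed.

Lemma induced_forest_cat P ts us :
  induced_forest P (ts ++ us) =
  induced_forest P ts ++ induced_forest (fun i => P (forest_nleaves ts + i)) us.
Proof.
elim: ts P => [//|t ts IH] P; rewrite /= IH -catA; congr (_ ++ (_ ++ _)).
by congr induced_forest; apply/funext => i; rewrite /forest_nleaves /= addnA.
Qed.

Lemma eq_induced_forest P P' ts :
  (forall i, i < forest_nleaves ts -> P i = P' i) ->
  induced_forest P ts = induced_forest P' ts.
Proof.
elim: ts P P' => [//|t ts IH] P P' e; rewrite /= (@eq_induced P P' t) => [|i it].
  congr cat; apply: IH => i its.
  by apply: e; rewrite /forest_nleaves /= ltn_add2l.
by apply: e; rewrite /forest_nleaves /= ltn_addr.
Qed.

Lemma induced_none P t : (forall i, i < nleaves t -> ~~ P i) -> induced P t = None.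
Proof.
move=> P0; rewrite (@eq_induced P pred0 t); last by move=> i /P0/negbTE.
move: t {P0 P}; apply: (tree_forest_ind (Q := fun ts => induced_forest pred0 ts = [::])).
- by [].
- by move=> t ts /= -> ->.
- by case=> [//|t ts] IH; rewrite induced_Node IH.
Qed.

(** Every vertex above the only selected leaf keeps a single child and is dropped. Hence a
    caterpillar with one selected leaf acts like a selected leaf. *)
Lemma induced_one x t : x < nleaves t -> induced (pred1 x) t = Some leaf.
Proof.
pose stF ts := forall x, x < forest_nleaves ts -> induced_forest (pred1 x) ts = [:: leaf].
have none ts P : (forall i, ~~ P i) -> induced_forest P ts = [::].
  by elim: ts P => [//|t' ts IH] P P0 /=; rewrite induced_none // IH.
move: t x; apply: (tree_forest_ind (Q := stF)).
- by [].
- move=> t ts IHt IHts x; rewrite /forest_nleaves /= => xlt.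
  case: (ltnP x (nleaves t)) => xt.
    by rewrite IHt //= none // => i; apply/eqP; lia.
  rewrite induced_none /= => [|i it]; last by apply/eqP; lia.
  rewrite (@eq_induced_forest _ (pred1 (x - nleaves t))); last first.
    by move=> i _ /=; apply/eqP/eqP; lia.
  by apply: IHts; rewrite /forest_nleaves; lia.
- move=> [|t ts] IH x; first by case: x.
  by move=> xlt; rewrite induced_Node IH.
Qed.

(** * The blow-up of a tree and the lifting of leaf selections to it *)

Section Blowup.
Variables d j : nat.

Fixpoint caterpillar (i : nat) : tree :=
  if i is i'.+1 then Node (caterpillar i' :: nseq d.-1 leaf) else leaf.

Lemma nleaves_nseq k : forest_nleaves (nseq k leaf) = k.
Proof. by rewrite /forest_nleaves map_nseq sumn_nseq mul1n. Qed.

Lemma nleaves_caterpillar i : nleaves (caterpillar i) = (i * d.-1).+1.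
Proof.
elim: i => [//|i IH]; rewrite /= IH [sumn _]nleaves_nseq; lia.
Qed.

Lemma all_strict_nseq k : all (strictly_dary d) (nseq k leaf).
Proof. by rewrite all_nseq /= orbT. Qed.

Lemma strictly_dary_caterpillar i : 0 < d -> strictly_dary d (caterpillar i).
Proof.
by move=> d0; elim: i => [//|i IH] /=; rewrite size_nseq prednK // eqxx IH all_strict_nseq.
Qed.

(* The possible choices of one of the first a = j(d-1) + 1 leaves of a
   caterpillar. *)
Definition block := 'I_(j * d.-1).+1.

(* The leftmost leaf is replaced by a caterpillar with [r] additional internal
   vertices, which serves to adjust the total number of leaves. *)
Fixpoint blowup (r : nat) (t : tree) : tree :=
  let fix go (r : nat) (ts : seq tree) : seq tree :=
    if ts is t :: ts1 then blowup r t :: go 0 ts1 else [::] in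
  let: Node ts := t in
  if nilp ts then caterpillar (j + r)
  else Node (go r ts ++ nseq (d - size ts) leaf).

Fixpoint blowup_forest (r : nat) (ts : seq tree) : seq tree :=
  if ts is t :: ts1 then blowup r t :: blowup_forest 0 ts1 else [::].

Lemma blowup_Node r t ts :
  blowup r (Node (t :: ts)) =
  Node (blowup_forest r (t :: ts) ++ nseq (d - (size ts).+1) leaf).
Proof. by []. Qed.

(* [g] lists, for each leaf of [t], [None] if that leaf is not selected, and
   otherwise the leaf of its caterpillar to select; the result is the sequence
   of selection bits of the leaves of [blowup r t]. *)
Fixpoint lift_mask (r : nat) (t : tree) (g : seq (option block)) : seq bool :=
  let fix go (r : nat) (ts : seq tree) (g : seq (option block)) : seq bool :=
    if ts is t :: ts1 then
      lift_mask r t (take (nleaves t) g) ++ go 0 ts1 (drop (nleaves t) g)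
    else [::] in
  let: Node ts := t in
  if nilp ts then
    mkseq (fun x => omap val (nth None g 0) == Some x) (nleaves (caterpillar (j + r)))
  else go r ts g ++ nseq (d - size ts) false.

Fixpoint lift_mask_forest (r : nat) (ts : seq tree) (g : seq (option block)) : seq bool :=
  if ts is t :: ts1 then
    lift_mask r t (take (nleaves t) g) ++ lift_mask_forest 0 ts1 (drop (nleaves t) g)
  else [::].

Lemma lift_mask_Node r t ts g :
  lift_mask r (Node (t :: ts)) g =
  lift_mask_forest r (t :: ts) g ++ nseq (d - (size ts).+1) false.
Proof. by []. Qed.

Lemma size_blowup_forest r ts : size (blowup_forest r ts) = size ts.
Proof. by elim: ts r => [//|t ts IH] r /=; rewrite IH. Qed.

Lemma forest_nleaves_cat ts us :
  forest_nleaves (ts ++ us) = forest_nleaves ts + forest_nleaves us.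
Proof. by rewrite /forest_nleaves map_cat sumn_cat. Qed.

Lemma nleaves_blowup_Node r t ts :
  nleaves (blowup r (Node (t :: ts))) =
  forest_nleaves (blowup_forest r (t :: ts)) + (d - (size ts).+1).
Proof.
rewrite -[LHS]/(forest_nleaves (blowup_forest r (t :: ts) ++ nseq (d - (size ts).+1) leaf)).
by rewrite forest_nleaves_cat nleaves_nseq.
Qed.

(** Only the leftmost caterpillar depends on [r], and each additional spine vertex adds [d.-1]
    leaves. *)
Lemma nleaves_blowup_shift r t : nleaves (blowup r t) = nleaves (blowup 0 t) + r * d.-1.
Proof.
move: t r; apply: (tree_forest_ind (Q := fun ts => forall r, ~~ nilp ts ->
  forest_nleaves (blowup_forest r ts) = forest_nleaves (blowup_forest 0 ts) + r * d.-1)).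
- by [].
- by move=> t ts IHt _ r _; rewrite /forest_nleaves /= IHt addnAC.
- case=> [|t ts] IH r; last by rewrite !nleaves_blowup_Node IH // addnAC.
  by rewrite /= !nleaves_caterpillar; lia.
Qed.

Lemma nleaves_blowup_le t : 1 < d -> dary d t ->
  nleaves (blowup 0 t) <= nleaves t * (j.+1 * d.-1).
Proof.
move=> d2 td.
(* The slack [d.-2] makes the induction close: a leaf attains equality, and a vertex with c >= 2
   children inherits slack c(d-2), which pays for its d-c extra leaves and for its own slack d-2. *)
suff: nleaves (blowup 0 t) + d.-2 <= nleaves t * (j.+1 * d.-1) by lia.
move: t td; apply: (tree_forest_ind (Q := fun ts => all (dary d) ts ->
  forest_nleaves (blowup_forest 0 ts) + size ts * d.-2
    <= forest_nleaves ts * (j.+1 * d.-1))).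
- by [].
- move=> t ts IHt IHts /= /andP[/IHt{}IHt /IHts{}IHts].
  by rewrite /forest_nleaves /= in IHt IHts *; lia.
- case=> [|t ts] IH; first by rewrite /= nleaves_caterpillar; lia.
  move=> /andP[sz /IH{}IH]; rewrite nleaves_blowup_Node nleaves_Node.
  apply: leq_trans IH; rewrite /= in sz *.
  have [c ->] : exists c, size ts = c.+1 by exists (size ts).-1; lia.
  by rewrite !mulSn; nia.
Qed.

Lemma strictly_dary_blowup r t : 0 < d -> dary d t -> strictly_dary d (blowup r t).
Proof.
move=> d0; move: t r; apply: (tree_forest_ind (Q := fun ts => forall r, all (dary d) ts ->
  all (strictly_dary d) (blowup_forest r ts))).
- by [].
- by move=> t ts IHt IHts r /= /andP[/IHt -> /IHts ->].
- case=> [|t ts] IH r; first by move=> _; exact: strictly_dary_caterpillar.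
  move=> /andP[sz td]; rewrite blowup_Node.
  rewrite /strictly_dary -/strictly_dary all_cat IH // all_strict_nseq andbT.
  rewrite size_cat size_blowup_forest size_nseq subnKC ?eqxx ?orbT //.
  by case/andP: sz.
Qed.

Lemma size_lift_mask r t g : size (lift_mask r t g) = nleaves (blowup r t).
Proof.
move: t r g; apply: (tree_forest_ind (Q := fun ts => forall r g,
  size (lift_mask_forest r ts g) = forest_nleaves (blowup_forest r ts))).
- by [].
- by move=> t ts IHt IHts r g; rewrite /= size_cat IHt IHts.
- case=> [|t ts] IH r g; first by rewrite /= size_mkseq.
  by rewrite lift_mask_Node nleaves_blowup_Node size_cat size_nseq IH.
Qed.

Lemma size_lift_mask_forest r ts g :
  size (lift_mask_forest r ts g) = forest_nleaves (blowup_forest r ts).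
Proof. by elim: ts r g => [//|t ts IH] r g; rewrite /= size_cat IH size_lift_mask. Qed.

Lemma lift_mask_leaf r o :
  lift_mask r leaf [:: o] =
  if o is Some x then mkseq (pred1 (val x)) (nleaves (caterpillar (j + r)))
  else nseq (nleaves (caterpillar (j + r))) false.
Proof.
case: o => [x|] /=.
  by apply: eq_mkseq => y; exact: eq_sym.
apply: (@eq_from_nth _ false); rewrite size_mkseq ?size_nseq // => i il.
by rewrite nth_mkseq // nth_nseq if_same.
Qed.

Lemma block_lt r (x : block) : val x < nleaves (caterpillar (j + r)).
Proof.
rewrite nleaves_caterpillar; apply: leq_trans (ltn_ord x) _.
by rewrite ltnS leq_mul2r leq_addr orbT.
Qed.

Lemma seq1P (T : Type) (g : seq T) : size g = 1 -> exists o, g = [:: o].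
Proof. by case: g => [|o [|]] // _; exists o. Qed.

Lemma count_lift_mask r t g : size g = nleaves t ->
  count id (lift_mask r t g) = count isSome g.
Proof.
move: t r g; apply: (tree_forest_ind (Q := fun ts => forall r g,
  size g = forest_nleaves ts -> count id (lift_mask_forest r ts g) = count isSome g)).
- by move=> r g /size0nil ->.
- move=> t ts IHt IHts r g; rewrite /forest_nleaves /= => sg.
  rewrite count_cat IHt ?size_takel ?sg ?leq_addr // IHts; last first.
    by rewrite size_drop sg addKn.
  by rewrite -count_cat cat_take_drop.
- case=> [|t ts] IH r g sg.
    have [o ->] := seq1P sg; rewrite lift_mask_leaf; case: o => [x|]; last first.
      by rewrite count_nseq.
    rewrite /mkseq count_map (@eq_count _ _ (pred1 (val x))) // count_uniq_mem ?iota_uniq //.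
    by rewrite mem_iota /= block_lt.
  by rewrite lift_mask_Node count_cat count_nseq IH // addn0.
Qed.

(** In each caterpillar the position of the only true bit, or its absence, recovers the entry of
    [g]. *)
Lemma lift_mask_inj r t g g' : size g = nleaves t -> size g' = nleaves t ->
  lift_mask r t g = lift_mask r t g' -> g = g'.
Proof.
move: t r g g'; apply: (tree_forest_ind (Q := fun ts => forall r g g',
  size g = forest_nleaves ts -> size g' = forest_nleaves ts ->
  lift_mask_forest r ts g = lift_mask_forest r ts g' -> g = g')).
- by move=> r g g' /size0nil -> /size0nil ->.
- move=> t ts IHt IHts r g g'; rewrite /forest_nleaves /= => sg sg' /eqP.
  rewrite eqseq_cat ?size_lift_mask // => /andP[/eqP e1 /eqP e2].
  rewrite -(cat_take_drop (nleaves t) g) -(cat_take_drop (nleaves t) g').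
  congr cat; first by apply: IHt e1; rewrite size_takel ?sg ?sg' ?leq_addr.
  by apply: IHts e2; rewrite size_drop ?sg ?sg' addKn.
- case=> [|t ts] IH r g g' sg sg'; last first.
    rewrite !lift_mask_Node => /eqP; rewrite eqseq_cat ?size_lift_mask_forest //.
    by move=> /andP[/eqP e _]; exact: IH e.
  have [o ->] := seq1P sg; have [o' ->] := seq1P sg'.
  move=> /(congr1 (fun s => nth false s)) e.
  have {}e x : x < nleaves (caterpillar (j + r)) ->
      (omap val o == Some x) = (omap val o' == Some x).
    by move=> xl; move: (congr1 (fun f => f x) e); rewrite /= !nth_mkseq.
  case: o o' e {sg sg'} => [x|] [x'|] // e.
  + by move: (e _ (block_lt r x)); rewrite /= eqxx => /esym/eqP[/val_inj ->].
  + by move: (e _ (block_lt r x)); rewrite /= eqxx.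
  + by move: (e _ (block_lt r x')); rewrite /= eqxx.
Qed.

Lemma induced_forest_leaves_none P k : (forall i, i < k -> ~~ P i) ->
  induced_forest P (nseq k leaf) = [::].
Proof.
move=> P0; rewrite (@eq_induced_forest P pred0).
  by elim: k {P0} => //.
by move=> i; rewrite nleaves_nseq => /P0/negbTE.
Qed.

(** Each caterpillar has at most one selected leaf and collapses to it or disappears, and the extra
    leaves are never selected. So every vertex of [t] keeps the same remaining children. *)
Lemma induced_lift_mask r t g : size g = nleaves t ->
  induced (nth false (lift_mask r t g)) (blowup r t) =
  induced (nth false (map isSome g)) t.
Proof.
move: t r g; apply: (tree_forest_ind (Q := fun ts => forall r g,
  size g = forest_nleaves ts ->
  induced_forest (nth false (lift_mask_forest r ts g)) (blowup_forest r ts) =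
  induced_forest (nth false (map isSome g)) ts)).
- by [].
- move=> t ts IHt IHts r g; rewrite /forest_nleaves /= => sg.
  congr (oapp _ _ _ ++ _).
    rewrite -[RHS](@eq_induced (nth false (map isSome (take (nleaves t) g)))); last first.
      by move=> i it; rewrite map_take nth_take.
    rewrite -(IHt r) ?size_takel ?sg ?leq_addr //; apply: eq_induced => i it.
    by rewrite nth_cat size_lift_mask it.
  rewrite [X in induced_forest X _ = _](_ : _ =
      nth false (lift_mask_forest 0 ts (drop (nleaves t) g))); last first.
    by apply/funext => i; rewrite nth_cat size_lift_mask ltnNge leq_addr addKn.
  rewrite IHts; last by rewrite size_drop sg addKn.
  by apply: eq_induced_forest => i it; rewrite map_drop nth_drop.
- case=> [|t ts] IH r g sg.
    have [o ->] := seq1P sg; rewrite lift_mask_leaf; case: o => [x|] /=.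
      rewrite -(@induced_one (val x) (caterpillar (j + r))) ?block_lt //.
      by apply: eq_induced => i il; rewrite nth_mkseq.
    by rewrite induced_none // => i _; rewrite nth_nseq if_same.
  rewrite lift_mask_Node blowup_Node.
  (* The head of the list of children appears only after reduction, so [induced_Node] is applied up
     to conversion. *)
  have -> ts' us : induced (nth false (lift_mask_forest r (t :: ts) g ++ nseq us false))
     (Node (blowup_forest r (t :: ts) ++ ts')) = root_of_forest (induced_forest
     (nth false (lift_mask_forest r (t :: ts) g ++ nseq us false))
       (blowup_forest r (t :: ts) ++ ts')) by exact: induced_Node.
  rewrite induced_Node induced_forest_cat (@induced_forest_leaves_none _ _); last first.
    move=> i il; rewrite nth_cat size_lift_mask_forest ltnNge leq_addr addKn.
    by rewrite nth_nseq if_same.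
  rewrite cats0 -(IH r) //; congr root_of_forest; apply: eq_induced_forest => i il.
  by rewrite nth_cat size_lift_mask_forest il.
Qed.

End Blowup.

(** By induction the leaf count below an internal vertex is congruent to its number of children, and
    d is congruent to 1 modulo d-1. *)
Lemma nleaves_strictly_dary d t : 0 < d -> strictly_dary d t ->
  nleaves t = 1 %[mod d.-1].
Proof.
move=> d0 td; apply/eqP.
move: t td; apply: (tree_forest_ind (Q := fun ts => all (strictly_dary d) ts ->
  forest_nleaves ts == size ts %[mod d.-1])).
- by [].
- move=> t ts IHt IHts /= /andP[/IHt/eqP {}IHt /IHts/eqP {}IHts].
  by rewrite /forest_nleaves /= -modnDm IHt IHts modnDm add1n.
- case=> [//|t ts] IH /andP[/eqP sz /IH]; rewrite nleaves_Node sz => /eqP ->.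
  by rewrite -{1}(prednK d0) -addn1 modnDl.
Qed.

(** * Counting induced subtrees *)

Lemma expn_sub_le_ffact m k : (m - k) ^ k <= m ^_ k.
Proof.
rewrite ffact_prod -[X in _ ^ X]card_ord -prod_nat_const.
by apply: leq_prod => i _; rewrite leq_sub2l // ltnW.
Qed.

Lemma ffact_le_expn n k : n ^_ k <= n ^ k.
Proof.
rewrite ffact_prod -[X in _ ^ X]card_ord -prod_nat_const.
by apply: leq_prod => i _; rewrite leq_subr.
Qed.

(** The inequality ((m-k)/n)^k <= C(m,k)/C(n,k) without denominators; multiplied by k!, it compares
    falling factorials with powers. *)
Lemma bin_expn_le m n k : (m - k) ^ k * 'C(n, k) <= 'C(m, k) * n ^ k.
Proof.
rewrite -(leq_pmul2r (fact_gt0 k)) -mulnA bin_ffact mulnAC bin_ffact.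
by rewrite leq_mul ?expn_sub_le_ffact ?ffact_le_expn.
Qed.

Definition mask_set n (M : seq bool) : {set 'I_n} := [set q : 'I_n | nth false M q].

Lemma card_mask_set n M : size M = n -> #|mask_set n M| = count id M.
Proof.
move=> sM; rewrite cardsE cardE /enum_mem size_filter -enumT.
rewrite -[in RHS](mkseq_nth false M) sM /mkseq -val_enum_ord -map_comp count_map.
by apply: eq_count.
Qed.

Lemma mask_set_inj n M M' : size M = n -> size M' = n ->
  mask_set n M = mask_set n M' -> M = M'.
Proof.
move=> sM sM' e; apply: (@eq_from_nth _ false); rewrite sM ?sM' // => i il.
by have /setP/(_ (Ordinal il)) := e; rewrite !inE.
Qed.

Lemma induced_mask_set T M :
  induced_subtree (mask_set (nleaves T) M) = induced (nth false M) T.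
Proof.
apply: eq_induced => i il /=.
by rewrite (fintype.mem_image val_inj _ (Ordinal il)) inE.
Qed.

(** [Q] is arbitrary so that copies of a tree and non-copies are counted alike. *)
Definition induced_count (Q : pred (option tree)) (k : nat) (T : tree) : nat :=
  #|[set S : {set 'I_(nleaves T)} | (#|S| == k) && Q (induced_subtree S)]|.

Lemma induced_countC Q k T :
  induced_count Q k T + induced_count (predC Q) k T = 'C(nleaves T, k).
Proof.
rewrite -[in RHS](card_ord (nleaves T)) -card_draws.
rewrite -(cardsID [set S | Q (induced_subtree S)] [set S : {set 'I_(nleaves T)} | #|S| == k]).
by congr (_ + _); apply: eq_card => S; rewrite !inE // andbC.
Qed.

(** * Comparison of the counts in a tree and in its blow-up *)

Section Count.
Variables (d j r : nat) (t : tree).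
Let m := nleaves t.
Let n := nleaves (blowup d j r t).
(** Profiles are finite functions so that they can be counted; [row] turns them into the lists that
    [lift_mask] expects. *)
Let profile := {ffun 'I_m -> option (block d j)}.
Let row (g : profile) := [seq g i | i <- enum 'I_m].

Let supp (g : profile) : {set 'I_m} := mask_set m (map isSome (row g)).
Let lifted (g : profile) : {set 'I_n} := mask_set n (lift_mask r t (row g)).

Let size_row g : size (row g) = m.
Proof. by rewrite size_map size_enum_ord. Qed.

(** Over a fixed support A, each leaf of A chooses its position in the block freely: these are the
    functions with support A and values other than [None]. *)
Lemma card_profile_supp (F : {set {set 'I_m}}) k : (forall A, A \in F -> #|A| = k) ->
  #|[set g | supp g \in F]| = #|F| * (j * d.-1).+1 ^ k.
Proof.
move=> Fk; rewrite -sum1dep_card (partition_big supp (mem F)) //=.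
rewrite -sum_nat_const; apply: eq_bigr => A AF; rewrite -(Fk _ AF).
have cardB : #|predC1 (None : option (block d j))| = (j * d.-1).+1.
  by rewrite cardC1 card_option card_ord.
rewrite -[in RHS]cardB -(card_pffun_on None A) sum1dep_card.
apply: eq_card => g; rewrite [in LHS]inE.
have suppE i : (i \in supp g) = (g i != None).
  rewrite inE -map_comp (nth_map i) ?size_enum_ord //= nth_ord_enum.
  by case: (g i).
apply/andP/pfamilyP => [[_ /eqP <-]|[gA gN]].
  split=> [|i]; last by rewrite suppE.
  by apply/supportP => i; rewrite suppE negbK => /eqP.
suff -> : supp g = A by [].
apply/setP => i; rewrite suppE; apply/idP/idP => [|/gN//].
by move: gA => /fintype.subsetP; apply.
Qed.

(** Profiles whose support is counted on the left are mapped by [lifted] injectively to sets counted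
    on the right; size and induced subtree are preserved. *)
Lemma induced_count_blowup Q k :
  induced_count Q k t * (j * d.-1).+1 ^ k <= induced_count Q k (blowup d j r t).
Proof.
rewrite -card_profile_supp; last by move=> A; rewrite inE => /andP[/eqP].
have lifted_inj : injective lifted.
  move=> g g' gg'; have e := mask_set_inj _ _ gg'; apply/ffunP => i.
  have /eq_in_map : row g = row g'.
    apply: (lift_mask_inj (size_row g) (size_row g')).
    by apply: e; exact: size_lift_mask.
  by apply; rewrite mem_enum.
rewrite -(card_imset _ lifted_inj); apply/subset_leq_card/fintype.subsetP => S /imsetP[g].
rewrite !inE => /andP[sg Qg] ->.
rewrite card_mask_set ?size_lift_mask // count_lift_mask ?size_row //.
rewrite induced_mask_set induced_lift_mask ?size_row // -induced_mask_set Qg andbT.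
rewrite -(eqP sg) card_mask_set; last by rewrite size_map size_row.
by rewrite count_map.
Qed.

End Count.

Local Open Scope ring_scope.

(** * Densities and limits superior *)

(** The index m may differ from n because the two sequences of the theorem run over different leaf
    counts. Boundedness turns each limit superior into an infimum of tail suprema. *)
Lemma limn_sup_le (R : realType) (u v : nat -> R) :
  (forall i, 0 <= u i <= 1) -> (forall i, 0 <= v i <= 1) ->
  (forall (K : nat) (e : R), 0 < e -> exists N, forall n, (N <= n)%N ->
     exists2 m, (K <= m)%N & u n <= e + v m) ->
  limn_sup u <= limn_sup v.
Proof.
have bnd (w : nat -> R) : (forall i, 0 <= w i <= 1) ->
    has_ubound (range w) * has_lbound (range w).
  by move=> w01; split; [exists 1 | exists 0] => _ [i _ <-]; case/andP: (w01 i).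
have supsE (w : nat -> R) : (forall i, 0 <= w i <= 1) ->
    limn_sup w = inf (range (sups w)).
  move=> /bnd[ub lb]; apply: (@cvg_lim R^o) => //.
  by have := @cvg_sups_inf R w ub lb.
move=> u01 v01 uv; rewrite !supsE //; apply: lb_le_inf; first by exists (sups v 0), 0%N.
move=> _ [K _ <-]; apply/ler_addgt0Pl => e /(uv K)[N Nuv].
(* The tail of [u] from N on is at most e plus the supremum of the tail of [v] from K on. *)
apply: (@le_trans _ _ (sups u N)).
  apply: ge_inf; last by exists N.
  exists 0 => _ [i _ <-]; apply: (@le_trans _ _ (u i)); first by case/andP: (u01 i).
  by apply: ub_le_sup; [apply: has_ubound_sdrop; apply: (bnd _ u01).1 | exists i => /=].
apply: ge_sup => [|_ [n /= /Nuv[m Km unm] <-]]; first by exists (u N), N => /=.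
apply: le_trans unm _; rewrite lerD2l; apply: ub_le_sup; last by exists m.
by apply: has_ubound_sdrop; apply: (bnd _ v01).1.
Qed.

(** Bernoulli's inequality on the unit interval. *)
Lemma one_sub_expr_le (R : realDomainType) (x : R) k :
  0 <= x <= 1 -> 1 - x ^+ k <= k%:R * (1 - x).
Proof.
move=> /andP[x0 x1]; elim: k => [|k IH]; first by rewrite expr0 subrr mul0r.
have -> : 1 - x ^+ k.+1 = (1 - x) + x * (1 - x ^+ k) by rewrite exprS; ring.
rewrite -natr1 mulrDl mul1r addrC lerD2r; apply: le_trans IH.
by rewrite ler_piMl // subr_ge0 exprn_ile1.
Qed.

Definition is_copy (D : tree) : pred (option tree) :=
  fun o => if o is Some U then `[< iso D U >] else false.

Lemma copiesE D T : copies D T = induced_count (is_copy D) (nleaves D) T.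
Proof. by apply: eq_card => S; rewrite [RHS]inE; apply/idP/idP => [/set_mem|/mem_set]. Qed.

Lemma density_itv (R : realType) D T : 0 <= density R D T <= 1.
Proof.
have le : (copies D T <= 'C(nleaves T, nleaves D))%N.
  by rewrite copiesE -(induced_countC (is_copy D)) leq_addr.
rewrite /density divr_ge0 ?ler0n //=; have [->|C0] := eqVneq 'C(nleaves T, nleaves D) 0%N.
  by rewrite invr0 mulr0 ler01.
by rewrite ler_pdivrMr ?ltr0n ?lt0n // mul1r ler_nat.
Qed.

Lemma density_blowup (R : realType) d j r D t : (nleaves D <= nleaves t)%N ->
  `|density R D t - density R D (blowup d j r t)| <=
  1 - ('C(nleaves t, nleaves D) * (j * d.-1).+1 ^ nleaves D)%:R
        / 'C(nleaves (blowup d j r t), nleaves D)%:R.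
Proof.
move=> Dt; rewrite /density !copiesE; set k := nleaves D; set q := is_copy D.
have c := induced_count_blowup d j r t q k.
have c' := induced_count_blowup d j r t (predC q) k.
have e := induced_countC q k t; have e' := induced_countC q k (blowup d j r t).
have C0 : (0 < 'C(nleaves t, k))%N by rewrite bin_gt0.
have A0 : (0 < (j * d.-1).+1 ^ k)%N by rewrite expn_gt0.
move: c c' C0 A0; rewrite -e -e'.
move: (induced_count q k t) (induced_count (predC q) k t)
  (induced_count q k (blowup d j r t)) (induced_count (predC q) k (blowup d j r t)) (_ ^ k)%N
  => x y x' y' a xa ya xy0 a0 {e e'}.
(* The blow-up also has sets of k leaves, so its density is a genuine quotient. *)
have xy0' : (0 < x' + y')%N by nia.
move: xa ya xy0 a0 xy0'; rewrite -!(ltr_nat R) -!(ler_nat R) !natrM !natrD.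
have := ler0n R x; have := ler0n R y.
move: (x%:R : R) (y%:R : R) (x'%:R : R) (y'%:R : R) (a%:R : R)
  => {}x {}y {}x' {}y' {}a y0 x0 xa ya xy0 a0 xy0'.
have exy : x / (x + y) * (x + y) = x by rewrite divfK ?gt_eqF.
have -> : 1 - (x + y) * a / (x' + y') = (x' + y' - (x + y) * a) / (x' + y').
  by field; rewrite gt_eqF.
have -> : x / (x + y) - x' / (x' + y') =
    (x / (x + y) * (x' + y') - x') / (x' + y').
  by field; rewrite !gt_eqF.
rewrite normrM [`|_^-1|]ger0_norm ?invr_ge0 ?(ltW xy0') // ler_pM2r ?invr_gt0 //.
have p0 : 0 <= x / (x + y) by rewrite divr_ge0 // ltW.
have p1 : x / (x + y) <= 1 by rewrite ler_pdivrMr // mul1r lerDl.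
move: exy p0 p1; move: (x / (x + y)) => p exy p0 p1.
(* With N = x' + y' and E = N - (x + y)a, the bound x' >= xa gives pN - x' <= pE, and y' >= ya gives
   x' - pN <= (1-p)E. *)
rewrite ler_norml; apply/andP; split; nra.
Qed.

(** * Approximation by strictly d-ary trees *)

Lemma exists_block_size d m n : (1 < d)%N -> (0 < m)%N -> (d.-1 * m <= n)%N ->
  exists j, [/\ (m * (j.+1 * d.-1) <= n)%N, (m * (j * d.-1).+1 <= n)%N
    & (n <= m * (j * d.-1).+1 + 2 * (d.-1 * m))%N].
Proof.
move=> d1 m0 mn; have q0 : (0 < m * d.-1)%N by rewrite muln_gt0 m0; lia.
have mdm : (m <= m * d.-1)%N by rewrite leq_pmulr //; lia.
have jle := leq_trunc_div (n - d.-1 * m) (m * d.-1).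
have jgt := ltn_ceil (n - d.-1 * m) q0.
(* The largest j with (j+1)(d-1)m <= n. By [nleaves_blowup_le] the blow-up then has at most n
   leaves, while the m blocks miss at most 2(d-1)m of them. *)
exists ((n - d.-1 * m) %/ (m * d.-1))%N; move: jle jgt mn.
move: (_ %/ _)%N => j; rewrite !mulnS mulSn !(mulnCA m j) mulnDr !(mulnCA m j).
by rewrite [(d.-1 * m)%N]mulnC; move: mdm; move: (m * d.-1)%N => q; split; lia.
Qed.

(** Squares instead of an integer square root let this serve both halves of the theorem. The first
    summand [d] of the constant covers small n, the second the blow-up. *)
Lemma strict_approximation (R : realType) d D T n : (1 < d)%N -> dary d T ->
    n = 1 %[mod d.-1] -> (nleaves T ^ 2 <= n < (nleaves T).+1 ^ 2)%N ->
  exists Tstar : tree, [/\ strictly_dary d Tstar, nleaves Tstar = n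
    & (nleaves D <= nleaves T)%N ->
      `|density R D T - density R D Tstar|
        <= (d%:R + (nleaves D * (2 * d + 2 * nleaves D))%:R) / Num.sqrt (n%:R : R)].
Proof.
move=> d1 Td n1 /andP[mn nm]; set m := nleaves T in mn nm *; set k := nleaves D.
have m0 : (0 < m)%N := nleaves_gt0 T.
have n0 : (0 < n)%N by apply: leq_trans mn; rewrite expn_gt0 m0.
set s := Num.sqrt (n%:R : R).
have s0 : 0 < s by rewrite sqrtr_gt0 ltr0n.
have s2 : s * s = n%:R by rewrite -expr2 sqr_sqrtr ?ler0n.
have ms : m%:R <= s.
  rewrite -(@ler_pXn2r _ 2) ?nnegrE ?ler0n ?(ltW s0) // expr2 [leRHS]expr2 s2.
  by rewrite -natrM ler_nat.
have sm : s <= 2 * m%:R.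
  rewrite -(@ler_pXn2r _ 2) ?nnegrE ?mulr_ge0 ?ler0n ?(ltW s0) // expr2 s2.
  by rewrite -natrM -natrX ler_nat; apply: leq_trans (ltnW nm) _; rewrite leq_exp2r //; lia.
have d0 : (0 < d)%N by lia.
(* If n < (d-1)m, then m <= s and s^2 = n give s <= d-1, so the claimed bound is at least 1 and any
   strictly d-ary tree with n leaves will do. *)
have [small|big] := ltnP n (d.-1 * m).
  exists (caterpillar d (n.-1 %/ d.-1)); split.
  - exact: strictly_dary_caterpillar.
  - rewrite nleaves_caterpillar divnK ?prednK // -[n.-1]subn1 -eqn_mod_dvd //.
    exact/eqP.
  move=> _; apply: (@le_trans _ _ 1).
    have /andP[p0 p1] := density_itv R D T.
    by case/andP: (density_itv R D (caterpillar d (n.-1 %/ d.-1))) => p0' p1';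
      rewrite ler_norml; apply/andP; split; lra.
  rewrite ler_pdivlMr // mul1r; apply: (@le_trans _ _ d%:R); last by rewrite lerDl ler0n.
  have : s * m%:R <= d.-1%:R * m%:R.
    rewrite -natrM; apply: (@le_trans _ _ n%:R); last by rewrite ler_nat ltnW.
    by rewrite -s2 ler_wpM2l // ltW.
  rewrite ler_pM2r ?ltr0n // => /le_trans; apply.
  by rewrite ler_nat leq_pred.
have [j [jn man nma]] := exists_block_size d1 m0 big.
have b0 : (nleaves (blowup d j 0 T) <= n)%N.
  exact: leq_trans (nleaves_blowup_le j d1 Td) _.
have dvd : (d.-1 %| n - nleaves (blowup d j 0 T))%N.
  rewrite -eqn_mod_dvd // n1; apply/eqP/esym/nleaves_strictly_dary => //.
  exact: strictly_dary_blowup.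
(* Both leaf counts are 1 modulo d-1, so lengthening the leftmost caterpillar fills the deficit
   exactly. *)
pose r := ((n - nleaves (blowup d j 0 T)) %/ d.-1)%N.
have bn : nleaves (blowup d j r T) = n.
  by rewrite nleaves_blowup_shift divnK // subnKC.
exists (blowup d j r T); split=> //; first exact: strictly_dary_blowup.
move=> km; apply: le_trans (density_blowup R d j r km) _; rewrite bn -/m -/k.
move: man nma; set a := (j * d.-1).+1 => man nma.
have nm_le : (m <= n)%N by apply: leq_trans man; rewrite leq_pmulr.
have nR0 : 0 < n%:R :> R by rewrite ltr0n.
have C0 : 0 < 'C(n, k)%:R :> R.
  by rewrite ltr0n bin_gt0 (leq_trans km).
(* By [bin_expn_le], x^k bounds the proportion of lifted sets from below; Bernoulli then reduces the
   error to k(1-x). *)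
pose x : R := ((m - k) * a)%:R / n%:R.
have x01 : 0 <= x <= 1.
  rewrite divr_ge0 ?ler0n //= ler_pdivrMr // mul1r ler_nat.
  by apply: leq_trans man; rewrite leq_mul2r leq_subr orbT.
have xk : x ^+ k <= ('C(m, k) * a ^ k)%:R / 'C(n, k)%:R.
  rewrite expr_div_n ler_pdivrMr ?exprn_gt0 // mulrAC ler_pdivlMr //.
  rewrite -!natrX -!natrM ler_nat expnMn mulnAC [leqRHS]mulnAC.
  by rewrite leq_mul2r bin_expn_le orbT.
apply: (@le_trans _ _ (1 - x ^+ k)); first by rewrite lerD2l lerN2.
apply: le_trans (one_sub_expr_le k x01) _.
rewrite mulrDl; apply: (@le_trans _ _ ((k * (2 * d + 2 * k))%:R / s)); last first.
  by rewrite lerDr divr_ge0 ?ler0n // ltW.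
rewrite natrM -mulrA ler_wpM2l // /x -s2 natrM natrB //.
have -> : 1 - (m%:R - k%:R) * a%:R / (s * s) =
    (s * s - (m%:R - k%:R) * a%:R) / s / s.
  by field; rewrite gt_eqF.
rewrite ler_pM2r ?invr_gt0 // ler_pdivrMr //.
have dd : d.-1%:R <= d%:R :> R by rewrite ler_nat leq_pred.
(* From am <= n = s^2 and s <= 2m. Then s^2 - (m-k)a <= 2(d-1)m + ka <= (2d + 2k)s. *)
have as2 : a%:R <= 2 * s.
  have : a%:R * m%:R <= s * m%:R * 2.
    apply: (@le_trans _ _ (s * s)); first by rewrite s2 -natrM ler_nat mulnC.
    by rewrite -mulrA ler_wpM2l ?(ltW s0) // mulrC.
  by rewrite mulrAC ler_pM2r ?ltr0n // mulrC.
have : s * s <= m%:R * a%:R + 2 * (d.-1%:R * m%:R).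
  by rewrite s2 -!natrM -natrD ler_nat.
have k0 := ler0n R k; have m0' := ler0n R m; have dR0 := ler0n R d.
have : k%:R * a%:R <= k%:R * (2 * s) by rewrite ler_wpM2l.
have : d.-1%:R * m%:R <= d%:R * s :> R by rewrite ler_pM.
by rewrite natrD !natrM; lra.
Qed.

(** * Maximal densities and equality of the two limits superior *)

Lemma density_le_max (R : realType) (C : tree -> bool) D T :
  C T -> density R D T <= max_density R C D (nleaves T).
Proof.
move=> CT; apply: ub_le_sup; last by exists T.
by exists 1 => _ [T' _ <-]; case/andP: (density_itv R D T').
Qed.

(** If no tree competes, the supremum of the empty set is 0 by convention, whence the hypothesis on
    x. *)
Lemma max_density_le (R : realType) (C : tree -> bool) D n (x : R) : 0 <= x ->
  (forall T, C T -> nleaves T = n -> density R D T <= x) -> max_density R C D n <= x.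
Proof.
move=> x0 le; rewrite /max_density; set E := (X in sup X).
have [->|/set0P E0] := eqVneq E set0; first by rewrite sup0.
by apply: ge_sup => // _ [T [CT Tn] <-]; exact: le.
Qed.

Lemma max_density_ge0 (R : realType) (C : tree -> bool) D n : 0 <= max_density R C D n.
Proof.
rewrite /max_density; set E := (X in sup X).
have [->|/set0P[_ [T [CT Tn] _]]] := eqVneq E set0; first by rewrite sup0.
have /andP[T0 _] := density_itv R D T.
by apply: le_trans T0 _; rewrite /E -Tn; exact: density_le_max.
Qed.

Lemma max_density_itv (R : realType) (C : tree -> bool) D n :
  0 <= max_density R C D n <= 1.
Proof.
rewrite max_density_ge0 max_density_le // => T _ _.
by case/andP: (density_itv R D T).
Qed.

Lemma strictly_dary_dary d t : (1 < d)%N -> strictly_dary d t -> dary d t.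
Proof.
move=> d1; move: t; apply: (tree_forest_ind
  (Q := fun ts => all (strictly_dary d) ts -> all (dary d) ts)) => //.
- by move=> t ts IHt IHts /= /andP[/IHt -> /IHts].
- move=> ts IH /= /andP[sz /IH ->]; rewrite andbT.
  by case/orP: sz => [-> //|/eqP ->]; rewrite d1 leqnn orbT.
Qed.

Lemma exists_index_between_squares d K m : (1 < d)%N -> (K <= m)%N -> (d <= m)%N ->
  exists2 j, (K <= j)%N & (m ^ 2 <= (j * d.-1).+1 < m.+1 ^ 2)%N.
Proof.
case: d => [|[|q]] // _ Km qm /=.
have jle := leq_trunc_div (m ^ 2) q.+1; have jgt := ltn_ceil (m ^ 2) (ltn0Sn q).
(* This is the first j with j(d-1) > m^2; it overshoots by at most d-1, less than the gap 2m+1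
   between the squares since d <= m. *)
exists (m ^ 2 %/ q.+1).+1; move: jle jgt; move: (_ %/ _)%N => j jle jgt; first by nia.
by apply/andP; split; nia.
Qed.

Theorem theorem5 (R : realType) (d : nat) (hd : (2 <= d)%N)
    (D : tree) (hD : dary d D) (hD2 : (2 <= nleaves D)%N) :
  (exists C : R, forall n : nat, (0 < n)%N -> n = 1 %[mod d.-1] ->
     forall T : tree, dary d T ->
       nleaves T = Num.truncn (Num.sqrt (n%:R : R)) ->
     exists Tstar : tree,
       [/\ strictly_dary d Tstar, nleaves Tstar = n
         & (nleaves D <= nleaves T)%N ->
           `|density R D T - density R D Tstar| <= C / Num.sqrt (n%:R : R)])
  /\ strict_inducibility R d D = inducibility R d D.
Proof.
(* The constant involves only [d] and the number of leaves of [D]. *)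
pose C0 : R := d%:R + (nleaves D * (2 * d + 2 * nleaves D))%:R.
split.
  exists C0 => n n0 n1 T Td Tn; apply: strict_approximation => //.
  have := truncn_itv (sqrtr_ge0 (n%:R : R)); rewrite -Tn => /andP[le lt].
  rewrite -!(ltr_nat R) -!(ler_nat R) !natrX -[n%:R]sqr_sqrtr ?ler0n //.
  by rewrite ler_pXn2r ?ltr_pXn2r ?nnegrE ?sqrtr_ge0 ?ler0n // le lt.
apply/eqP; rewrite eq_le; apply/andP; split; apply: limn_sup_le => [i|i|K e e0];
  rewrite ?max_density_itv //.
  (* Strictly d-ary trees are d-ary, so the same leaf count is used on both sides. *)
  exists K => i Ki; exists (i * d.-1).+1; first by nia.
  apply: max_density_le => [|T Td Tn]; first by rewrite addr_ge0 ?max_density_ge0 ?ltW.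
  rewrite -Tn; apply: le_trans (density_le_max R D (strictly_dary_dary hd Td)) _.
  by rewrite lerDr ltW.
have C0_ge0 : 0 <= C0 by rewrite addr_ge0 ?ler0n.
(* The last summand forces C0/e < m <= sqrt n, hence an error of at most e; the others make the
   index lemma and the approximation applicable. *)
exists (K + d + nleaves D + (Num.truncn (C0 / e)).+1)%N => m mN.
have [Km dm Dm Cm] :
  [/\ (K <= m)%N, (d <= m)%N, (nleaves D <= m)%N & (Num.truncn (C0 / e) < m)%N].
  by split; lia.
have [j Kj mj] := exists_index_between_squares hd Km dm.
exists j => //.
apply: max_density_le => [|T Td Tn]; first by rewrite addr_ge0 ?max_density_ge0 ?ltW.
set n := (j * d.-1).+1 in mj *.
rewrite -Tn in mj.
have n1 : n = 1 %[mod d.-1] by rewrite /n -addn1 modnMDl.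
have [U [Ud Un]] := strict_approximation R D hd Td n1 mj.
rewrite Tn => /(_ Dm) close.
have close_e : `|density R D T - density R D U| <= e.
  apply: le_trans close _; rewrite ler_pdivrMr ?sqrtr_gt0 ?ltr0n //.
  rewrite mulrC -ler_pdivrMr // -/C0.
  apply: le_trans (ltW (truncnS_gt _)) _; apply: (@le_trans _ _ m%:R).
    by rewrite ler_nat.
  rewrite -(@ler_pXn2r _ 2) ?nnegrE ?sqrtr_ge0 ?ler0n // sqr_sqrtr ?ler0n //.
  by rewrite -natrX ler_nat -Tn; case/andP: mj.
have := density_le_max R (C := strictly_dary d) D Ud; rewrite Un.
by move: close_e; rewrite ler_norml => /andP[_]; lra.
Qed.
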